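(* Let $G$ be a connected $(c,d)$-biregular simple graph with $c,d\ge2$ and $(c,d)\ne(2,2)$, which is not $K_{2,3}$, $K_{2,4}$, $K_{2,5}$, or $K_{3,3}$. Then \[ \mathscr{K}_e(G)>\mathscr{K}_{nb}(G). \]
   Context: A $(c,d)$-biregular graph is a bipartite graph in which every vertex in one part of the bipartition has degree $c$ and every vertex in the other part has degree $d$. Kemeny's constant of an irreducible finite Markov chain with transition matrix $P$ whose eigenvalues (with multiplicity) are $1=\rho_1,\rho_2,\dots,\rho_N$ (with $1$ simple) is $\mathscr{K}(P)=\sum_{i=2}^{N}\frac{1}{1-\rho_i}$. Arcs of $G$: for each edge $\{u,v\}$ the two ordered pairs $(u,v),(v,u)$. $\mathscr{K}_e(G)$ is Kemeny's constant of the chain on arcs where from $(u,v)$ one moves to $(v,w)$ with probability $1/\deg(v)$ for each neighbor $w$ of $v$. $\mathscr{K}_{nb}(G)$ is Kemeny's constant of the non-backtracking chain on arcs where from $(u,v)$ one moves to $(v,w)$ with probability $1/(\deg(v)-1)$ for each neighbor $w\neq u$ of $v$. *)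

(* Defs.v *)
From HB Require Import structures.
From mathcomp Require Import all_boot all_order all_algebra all_field.
Set Implicit Arguments. Unset Strict Implicit. Unset Printing Implicit Defensive.
Import Order.TTheory GRing.Theory Num.Theory.
Local Open Scope ring_scope.

Definition simple_graph (V : finType) (e : rel V) : Prop :=
  symmetric e /\ irreflexive e.

Definition connected_graph (V : finType) (e : rel V) : Prop :=
  forall u v : V, connect e u v.

Definition deg (V : finType) (e : rel V) (v : V) : nat := #|[set w | e v w]|.

Definition biregular (V : finType) (e : rel V) (c d : nat) : Prop :=
  exists X : {set V},
    [/\ (forall u v, e u v -> (u \in X) != (v \in X)),
        (forall v, v \in X -> deg e v = c) &
        (forall v, v \notin X -> deg e v = d)].

Definition Kbip (m n : nat) : rel ('I_m + 'I_n)%type :=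
  fun x y => is_inl x != is_inl y.

Arguments Kbip m%_N n%_N : clear implicits.

Definition graph_iso (V W : finType) (e : rel V) (f : rel W) : Prop :=
  exists g : V -> W, bijective g /\ forall u v, f (g u) (g v) = e u v.

Definition arc (V : finType) (e : rel V) : predArgType :=
  {x : V * V | e x.1 x.2}.

(* Kemeny's constant: sum of 1/(1 - rho) over the eigenvalues (with
   multiplicity, in algC) of P, one copy of the eigenvalue 1 removed. *)
Definition eigenvalues (n : nat) (P : 'M[algC]_n) : seq algC :=
  sval (closed_field_poly_normal (char_poly P)).

Definition kemeny (n : nat) (P : 'M[algC]_n) : algC :=
  \sum_(r <- rem 1 (eigenvalues P)) (1 - r)^-1.

Definition trans_mx (T : finType) (p : T -> T -> algC) : 'M[algC]_#|T| :=
  \matrix_(i, j) p (enum_val i) (enum_val j).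

Definition edge_chain (V : finType) (e : rel V) (a b : arc e) : algC :=
  if (val a).2 == (val b).1 then ((deg e (val a).2)%:R)^-1 else 0.

Definition nb_chain (V : finType) (e : rel V) (a b : arc e) : algC :=
  if ((val a).2 == (val b).1) && ((val b).2 != (val a).1)
  then ((deg e (val a).2)%:R - 1)^-1 else 0.

Definition Kemeny_e (V : finType) (e : rel V) : algC :=
  kemeny (trans_mx (@edge_chain V e)).
Definition Kemeny_nb (V : finType) (e : rel V) : algC :=
  kemeny (trans_mx (@nb_chain V e)).

(* Main.v *)
(** Both chains are compressed to the smaller side [X] of the bipartition. With
    [B] the biadjacency matrix, Sylvester's determinant identity (in its Ihara-Bass
    form for the non-backtracking chain, the arc reversal being inverted by hand)
    expresses both characteristic polynomials through the eigenvalues [c d s_i] of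
    [B B^T]. Since Kemeny's constant is the logarithmic derivative at [1] of the
    characteristic polynomial with one factor [X - 1] removed, this gives
      K_e - K_nb = 2 (S (c + d) / (c d) - p / c - 1 / (c d - c - d)),
    where [p = #|X|] and [S] is the sum of [1 / (1 - s_i)] over [s_i <> 1];
    connectedness makes [s = 1] simple. The trace of [B B^T] fixes the sum of the
    [s_i], so Cauchy-Schwarz gives [S >= (p - 1)^2 d / (p (d - 1))]. Taking
    [d <= c], and using [p >= d], what remains is a polynomial inequality that fails
    only for the excluded complete bipartite graphs. *)

Require Import Defs.
From HB Require Import structures.
From mathcomp Require Import all_boot all_order all_algebra all_field.
From mathcomp Require Import ring zify.
Import Order.TTheory GRing.Theory Num.Theory.
Local Open Scope ring_scope.

(** * Sums over the roots of a polynomial *)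

(* Inversion maps [0] to [0], so roots equal to [1] contribute nothing. *)
Definition root_sum (C : numClosedFieldType) (f : {poly C}) : C :=
  \sum_(r <- sval (closed_field_poly_normal f)) (1 - r)^-1.

Section RootSum.

Variable C : numClosedFieldType.
Implicit Types (f g : {poly C}) (s : seq C).

Lemma root_sum_normal (a : C) s : a != 0 ->
  root_sum C (a *: \prod_(z <- s) ('X - z%:P)) = \sum_(r <- s) (1 - r)^-1.
Proof.
move=> a0; rewrite /root_sum; case: closed_field_poly_normal => t /=.
have -> : lead_coef (a *: \prod_(z <- s) ('X - z%:P)) = a.
  by rewrite lead_coefZ (monicP (monic_prod_XsubC _ _ _)) mulr1.
by move=> /(scalerI a0)/prod_XsubC_eq st; rewrite (perm_big _ st).
Qed.

Lemma root_sumM f g : f * g != 0 ->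
  root_sum C (f * g) = root_sum C f + root_sum C g.
Proof.
rewrite mulf_eq0 negb_or => /andP[f0 g0].
have [s Df] := closed_field_poly_normal f.
have [t Dg] := closed_field_poly_normal g.
have lf : lead_coef f != 0 by rewrite lead_coef_eq0.
have lg : lead_coef g != 0 by rewrite lead_coef_eq0.
rewrite Df Dg !root_sum_normal // -scalerAl -scalerAr scalerA -big_cat.
by rewrite root_sum_normal ?mulf_neq0 // big_cat.
Qed.

Lemma root_sum1 : root_sum C 1 = 0.
Proof.
have := @root_sum_normal 1 [::] (oner_neq0 C).
by rewrite !big_nil scale1r.
Qed.

Lemma root_sumX f n : f != 0 -> root_sum C (f ^+ n) = root_sum C f *+ n.
Proof.
move=> f0; elim: n => [|n IH]; first by rewrite expr0 root_sum1.
by rewrite exprS root_sumM -?exprS ?expf_neq0 // IH mulrS.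
Qed.

Lemma root_sum_prod (I : finType) (F : I -> {poly C}) :
  (forall i, F i != 0) -> root_sum C (\prod_i F i) = \sum_i root_sum C (F i).
Proof.
move=> F0; elim: (index_enum I) => [|i s IH]; first by rewrite !big_nil root_sum1.
by rewrite !big_cons root_sumM ?IH // mulf_neq0 // prodf_seq_neq0; apply/allP=> j _ /=.
Qed.

Lemma root_sum_XsubC1 : root_sum C ('X - 1%:P) = 0.
Proof.
have := @root_sum_normal 1 [:: 1] (oner_neq0 C).
by rewrite !big_seq1 scale1r subrr invr0.
Qed.

(** The logarithmic derivative of a product of factors ['X - r%:P] is the sum of the [1 / (X - r)],
    here evaluated at 1. *)
Lemma root_sum_horner f : f.[1] != 0 -> root_sum C f = f^`().[1] / f.[1].
Proof.
have [s Df] := closed_field_poly_normal f.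
rewrite Df; have [->|lf] := eqVneq (lead_coef f) 0; first by rewrite scale0r horner0 eqxx.
rewrite root_sum_normal // derivZ !hornerZ mulf_eq0 negb_or lf /=.
rewrite -mulf_div divff // mul1r.
elim: s {Df} => [|r s IH]; first by rewrite !big_nil derivC horner0 mul0r.
rewrite !big_cons hornerM !hornerXsubC mulf_eq0 negb_or => /andP[r0 s0].
rewrite IH // derivM derivXsubC mul1r hornerD hornerM hornerXsubC.
by field; rewrite r0 s0.
Qed.

Lemma quadratic_neq0 (k : C) : 'X^2 + k%:P != 0 :> {poly C}.
Proof.
apply/eqP=> /polyP/(_ 2%N); rewrite !coefE /= addr0 => /eqP.
by rewrite oner_eq0.
Qed.

Lemma quartic_neq0 (k m : C) : 'X^4 + k%:P * 'X^2 + m%:P != 0 :> {poly C}.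
Proof.
apply/eqP=> /polyP/(_ 4%N); rewrite !coefE /= mulr0 !addr0 => /eqP.
by rewrite oner_eq0.
Qed.

Lemma root_sum_polyX : root_sum C 'X = 1.
Proof.
by rewrite root_sum_horner ?hornerX ?oner_eq0 // derivX hornerC divr1.
Qed.

Lemma root_sum_quadratic (k : C) : 1 + k != 0 ->
  root_sum C ('X^2 + k%:P) = 2 / (1 + k).
Proof.
have E : ('X^2 + k%:P).[1] = 1 + k by rewrite !hornerE expr1n.
move=> k1; rewrite root_sum_horner E // derivD derivXn derivC addr0 hornerMn.
by rewrite hornerXn expr1n.
Qed.

(** The root 1 contributes the inverse of 0, that is 0, so only the root -1 counts. *)
Lemma root_sum_X2sub1 : root_sum C ('X^2 + (-1)%:P) = 2^-1.
Proof.
have E : 'X^2 + (-1)%:P = ('X - 1%:P) * ('X + 1%:P) :> {poly C} by ring.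
have E1 : ('X + 1%:P).[1] = 2 :> C by rewrite hornerD hornerX hornerC.
have two : 2 != 0 :> C by rewrite pnatr_eq0.
rewrite E root_sumM -?E ?quadratic_neq0 // root_sum_XsubC1 add0r.
by rewrite root_sum_horner E1 // derivD derivX derivC addr0 hornerC mul1r.
Qed.

Lemma root_sum_quartic (k m : C) : 1 + k + m != 0 ->
  root_sum C ('X^4 + k%:P * 'X^2 + m%:P) = (4 + 2 * k) / (1 + k + m).
Proof.
have E : ('X^4 + k%:P * 'X^2 + m%:P).[1] = 1 + k + m.
  by rewrite !(hornerXn, hornerD, hornerC, hornerM) !expr1n; ring.
move=> km; rewrite root_sum_horner E //; congr (_ / _).
rewrite !derivD derivM !derivXn !derivC.
by rewrite !(hornerXn, hornerMn, hornerD, hornerC, horner0, hornerM) !expr1n; ring.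
Qed.

(** A quartic of this shape that vanishes at 1 factors as [(X^2 - 1) (X^2 - m)]. This is the factor
    of the principal eigenvalue in the non-backtracking chain. *)
Lemma root_sum_quartic1 (k m : C) : 1 + k + m = 0 -> 1 - m != 0 ->
  root_sum C ('X^4 + k%:P * 'X^2 + m%:P) = 2^-1 + 2 / (1 - m).
Proof.
move=> km m1.
have -> : 'X^4 + k%:P * 'X^2 + m%:P = ('X^2 + (-1)%:P) * ('X^2 + (- m)%:P).
  have -> : k = - 1 - m by rewrite -[RHS]add0r -km; ring.
  by ring.
rewrite root_sumM ?mulf_neq0 ?root_sum_X2sub1 ?root_sum_quadratic //;
  exact: quadratic_neq0.
Qed.

Lemma sum_rem1 s : \sum_(r <- rem 1 s) (1 - r)^-1 = \sum_(r <- s) (1 - r)^-1.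
Proof.
have [s1|/rem_id -> //] := boolP (1 \in s).
by rewrite [RHS](perm_big _ (perm_to_rem s1)) big_cons /= subrr invr0 add0r.
Qed.

End RootSum.

Lemma kemeny_root_sum (n : nat) (P : 'M[algC]_n) :
  kemeny P = root_sum algC (char_poly P).
Proof.
exact: sum_rem1.
Qed.

(** * Determinant identities *)

Section Determinants.

Variable A : comNzRingType.

(* Sylvester's identity, where multiplication by [R'] plays the role of
   [y * R^-1]. *)
Lemma det_sub_mulmx (m k : nat) (y : A) (R R' : 'M[A]_m) (U : 'M[A]_(m, k))
    (S : 'M[A]_(k, m)) : R *m R' = y%:M ->
  \det (R - U *m S) * (\det R' * y ^+ k) = y ^+ m * \det (y%:M - S *m R' *m U).
Proof.
(* Two block column operations evaluate the determinant of [M]: the first clears [S], the second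
   clears [U] with [R'] standing in for the inverse of [R]. *)
move=> RR'; pose M := block_mx R U S 1%:M.
have <- : \det M = \det (R - U *m S).
  have : M *m block_mx 1%:M 0 (- S) 1%:M = block_mx (R - U *m S) U 0 1%:M.
    by rewrite mulmx_block !mulmx1 !mul1mx !mulmx0 !add0r mulmxN subrr.
  move/(congr1 (fun M => \det M)).
  by rewrite det_mulmx det_lblock det_ublock !det1 !mulr1.
have : M *m block_mx R' (- (R' *m U)) 0 y%:M =
       block_mx y%:M 0 (S *m R') (y%:M - S *m R' *m U).
  rewrite mulmx_block !mulmx0 !addr0 !mulmxN !mulmxA RR' mul1mx mul_scalar_mx.
  by rewrite mul_mx_scalar addNr [- _ + _]addrC.
move/(congr1 (fun M => \det M)).
by rewrite det_mulmx det_lblock det_ublock !det_scalar.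
Qed.

(** A Schur complement without division: a lower triangular block matrix of determinant [a' ^+ p]
    clears the lower left block. *)
Lemma det_scalar_block (p q : nat) (a a' b b' : A) (B : 'M[A]_(p, q))
    (B' : 'M[A]_(q, p)) :
  \det (block_mx a%:M (- (b *: B)) (- (b' *: B')) a'%:M) * a' ^+ p =
  \det ((a * a')%:M - (b * b') *: (B *m B')) * a' ^+ q.
Proof.
have : block_mx a%:M (- (b *: B)) (- (b' *: B')) a'%:M *m
       block_mx a'%:M 0 (b' *: B') 1%:M =
       block_mx ((a * a')%:M - (b * b') *: (B *m B')) (- (b *: B)) 0 a'%:M.
  rewrite mulmx_block !mulmx0 !mulmx1 !add0r mul_scalar_mx mul_mx_scalar.
  rewrite mul_scalar_mx scale_scalar_mx scalerN addNr.
  by rewrite mulNmx -scalemxAl -scalemxAr scalerA.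
move/(congr1 (fun M => \det M)).
by rewrite det_mulmx det_lblock det_ublock !det_scalar expr1n mulr1.
Qed.

End Determinants.

(** * Spectrum of the Gram matrix of a biregular biadjacency matrix *)

Section Gram.

Variables (C : numClosedFieldType) (p q c d : nat) (b : 'I_p -> 'I_q -> bool).

Local Notation B := (\matrix_(x < p, y < q) (b x y)%:R : 'M[C]_(p, q)).

Hypothesis row_sum : forall x, (\sum_y b x y)%N = c.
Hypothesis col_sum : forall y, (\sum_x b x y)%N = d.

(* The variance of [v] over the neighbours of each [y], summed over [y]. *)
Lemma gram_defect (v : 'rV[C]_p) :
  \sum_y \sum_x (b x y)%:R * `|d%:R * v 0 x - (v *m B) 0 y| ^+ 2 =
  d%:R ^+ 2 * c%:R * (\sum_x `|v 0 x| ^+ 2) -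
  d%:R * (\sum_y `|(v *m B) 0 y| ^+ 2) :> C.
Proof.
have row_sumC x : \sum_y (b x y)%:R = c%:R :> C by rewrite -natr_sum row_sum.
have col_sumC y : \sum_x (b x y)%:R = d%:R :> C by rewrite -natr_sum col_sum.
have wE y : (v *m B) 0 y = \sum_x (b x y)%:R * v 0 x.
  by rewrite mxE; apply: eq_bigr => x _; rewrite mxE mulrC.
transitivity (\sum_y (d%:R ^+ 2 * (\sum_x (b x y)%:R * `|v 0 x| ^+ 2)
                     - d%:R * `|(v *m B) 0 y| ^+ 2)).
  apply: eq_bigr => y _; set w := (v *m B) 0 y.
  have wC : w^* = \sum_x (b x y)%:R * (v 0 x)^*.
    rewrite /w wE rmorph_sum; apply: eq_bigr => x _.
    by rewrite rmorphM /= conjC_nat.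
  transitivity (d%:R ^+ 2 * (\sum_x (b x y)%:R * `|v 0 x| ^+ 2)
     - d%:R * w^* * (\sum_x (b x y)%:R * v 0 x)
     - d%:R * w * (\sum_x (b x y)%:R * (v 0 x)^*)
     + w * w^* * \sum_x (b x y)%:R).
    rewrite !mulr_sumr -!sumrB -big_split /=; apply: eq_bigr => x _.
    rewrite !normCK rmorphB rmorphM /= conjC_nat; ring.
  by rewrite -wE -wC col_sumC -/w normCK; ring.
rewrite sumrB -!mulr_sumr exchange_big /= -mulrA; congr (_ * _ - _).
rewrite mulr_sumr; apply: eq_bigr => x _.
by rewrite -mulr_suml row_sumC.
Qed.

Hypothesis d_gt0 : (0 < d)%N.
Hypothesis p_gt0 : (0 < p)%N.
Hypothesis conn : forall v : 'I_p -> C,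
  (forall x x' y, b x y -> b x' y -> v x = v x') -> forall x x', v x = v x'.

(** By [gram_defect], [d * (c * d - l i)] is a sum of variances of a unit eigenvector. So
    [l i <= c * d], and equality makes the eigenvector constant around each [y], hence constant by
    [conn]. The determinant is stated for polynomials [f] and [g] because each chain substitutes its
    own pair. *)
Lemma gram_spectrum :
  exists (l : 'I_p -> C) (i0 : 'I_p),
  [/\ forall f g : {poly C},
        \det (f%:M - g *: map_mx polyC (B *m B^T)) = \prod_i (f - g * (l i)%:P),
      l i0 = c%:R * d%:R,
      forall i, i != i0 -> l i < c%:R * d%:R &
      \sum_i l i = p%:R * c%:R].
Proof.
set A := B *m B^T.
have BC : map_mx Num.conj B^T = B^T by apply/matrixP=> i j; rewrite !mxE conjC_nat.
have normA : A \is normalmx.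
  apply: symmetric_normalmx.
    by apply/is_hermitianmxP; rewrite expr0 scale1r map_mx_id // trmx_mul trmxK.
  apply/mxOverP=> i j; rewrite mxE rpred_sum // => k _.
  by rewrite !mxE -natrM; apply: realn.
have [P [D [PP DA]]] : exists (P : 'M[C]_p) (D : 'rV[C]_p),
    P *m map_mx Num.conj P^T = 1%:M /\ A = map_mx Num.conj P^T *m diag_mx D *m P.
  exists (spectralmx A), (spectral_diag A); split.
    exact/unitarymxP/spectral_unitarymx.
  by rewrite {1}(orthomx_spectralP normA) invmx_unitary // spectral_unitarymx.
pose l i := D 0 i.
have PP' : map_mx Num.conj P^T *m P = 1%:M by apply: mulmx1C.
have DP : P *m A *m map_mx Num.conj P^T = diag_mx (D).
  by rewrite DA !mulmxA PP mul1mx -mulmxA PP mulmx1.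
have detE (f g : {poly C}) :
    \det (f%:M - g *: map_mx polyC A) = \prod_i (f - g * (l i)%:P).
  have -> : f%:M - g *: map_mx polyC A = map_mx polyC (map_mx Num.conj P^T) *m
    diag_mx (\row_i (f - g * (l i)%:P)) *m map_mx polyC P.
    have -> : diag_mx (\row_i (f - g * (l i)%:P)) =
        f%:M - g *: map_mx polyC (diag_mx (D)).
      apply/matrixP=> i j; rewrite !mxE.
      by case: eqVneq => _; rewrite ?mulr1n ?mulr0n ?mulr0 ?subr0.
    rewrite {1}DA !map_mxM mulmxBr mulmxBl -!scalemxAr -!scalemxAl.
    rewrite mul_mx_scalar -scalemxAl.
    by rewrite -[map_mx polyC (map_mx _ _) *m map_mx polyC P]map_mxM PP' map_mx1 scalemx1.
  rewrite !det_mulmx det_diag mulrC mulrA -det_mulmx -map_mxM PP map_mx1 det1.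
  by rewrite mul1r; apply: eq_bigr => i _; rewrite mxE.
have unit_row i : \sum_x `|P i x| ^+ 2 = 1.
  move/matrixP/(_ i i): PP; rewrite !mxE eqxx; apply: etrans.
  by apply: eq_bigr => x _; rewrite !mxE normCK.
have lE i : l i = \sum_y `|(row i P *m B) 0 y| ^+ 2.
  move/matrixP/(_ i i): DP; rewrite [RHS]mxE eqxx mulr1n /l => <-.
  rewrite /A -!mulmxA mulmxA.
  have -> : B^T *m map_mx Num.conj P^T = map_mx Num.conj (P *m B)^T.
    by rewrite trmx_mul map_mxM BC.
  rewrite mxE; apply: eq_bigr => y _.
  by rewrite normCK -row_mul !mxE.
have d0 : d%:R != 0 :> C by rewrite pnatr_eq0 -lt0n.
have dpos : 0 < d%:R :> C by rewrite ltr0n.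
have defect i : d%:R * (c%:R * d%:R - l i) =
    \sum_y \sum_x (b x y)%:R * `|d%:R * P i x - (row i P *m B) 0 y| ^+ 2.
  have := gram_defect (row i P).
  rewrite -lE (eq_bigr (fun x => `|P i x| ^+ 2)); last by move=> x _; rewrite mxE.
  rewrite unit_row mulr1 => def.
  transitivity (d%:R ^+ 2 * c%:R - d%:R * l i); first by ring.
  by rewrite -def; apply: eq_bigr => y _; apply: eq_bigr => x _; rewrite mxE.
have term_ge0 i x y :
    0 <= (b x y)%:R * `|d%:R * P i x - (row i P *m B) 0 y| ^+ 2.
  by rewrite mulr_ge0 ?ler0n ?exprn_ge0.
have l_le i : l i <= c%:R * d%:R.
  rewrite -subr_ge0 -(pmulr_rge0 _ dpos) defect.
  by apply: sumr_ge0 => y _; apply: sumr_ge0 => x _.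
have const i : l i = c%:R * d%:R -> forall x x', P i x = P i x'.
  move=> li; apply: conn => x x' y bxy bx'y.
  have /eqP := defect i; rewrite li subrr mulr0 eq_sym psumr_eq0; last first.
    by move=> y' _; apply: sumr_ge0 => x'' _.
  move=> /allP/(_ y (mem_index_enum _)) /=.
  rewrite psumr_eq0 // => /allP z.
  have eqw x1 : b x1 y -> d%:R * P i x1 = (row i P *m B) 0 y.
    move=> b1; have := z x1 (mem_index_enum _); rewrite /= b1 mul1r.
    by rewrite sqrf_eq0 normr_eq0 subr_eq0 => /eqP.
  by apply: (mulfI d0); rewrite (eqw x) // (eqw x').
have [i0 li0] : exists i0, l i0 = c%:R * d%:R.
  (* The all-ones vector is an eigenvector for [c * d], so some factor of the determinant at [c * d]
     vanishes. *)
  have e1 : (const_mx 1 : 'rV[C]_p) *m ((c%:R * d%:R)%:M - A) = 0.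
    apply/eqP; rewrite mulmxBr subr_eq0 mul_mx_scalar /A mulmxA; apply/eqP.
    have -> : (const_mx 1 : 'rV[C]_p) *m B = const_mx d%:R.
      apply/rowP=> y; rewrite !mxE -(col_sum y) natr_sum.
      by apply: eq_bigr => x _; rewrite !mxE mul1r.
    apply/rowP=> x; rewrite !mxE mulr1 -(row_sum x) natr_sum mulr_suml.
    by apply: eq_bigr => y _; rewrite !mxE mulrC.
  have : \prod_i (c%:R * d%:R - l i) == 0.
    have := detE (c%:R * d%:R)%:P 1.
    rewrite scale1r => /(congr1 (fun f : {poly C} => f.[0])).
    rewrite horner_prod => detA.
    have -> : \prod_i (c%:R * d%:R - l i) = \det ((c%:R * d%:R)%:M - A).
      transitivity (\det (map_mx polyC ((c%:R * d%:R)%:M - A))).[0].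
        rewrite map_mxB map_scalar_mx detA; apply: eq_bigr => i _.
        by rewrite mul1r -polyCB hornerC.
      by rewrite det_map_mx hornerC.
    apply/det0P; exists (const_mx 1) => //.
    apply/eqP=> /rowP/(_ (Ordinal p_gt0)); rewrite !mxE => /eqP.
    by rewrite oner_eq0.
  by case/prodf_eq0 => i _; rewrite subr_eq0 => /eqP li; exists i.
exists l, i0; split => // [i ii0|].
  rewrite lt_neqAle l_le andbT; apply/eqP => li.
  (* Rows [i] and [i0] of [P] would both be constant, yet they are orthogonal. So one of them is
     zero, against its unit norm. *)
  move/matrixP/(_ i i0): PP; rewrite !mxE (negPf ii0) /= mulr0n => Z.
  have [x0 _] : exists x0 : 'I_p, true by exists (Ordinal p_gt0).
  have /eqP : P i x0 * (P i0 x0)^* *+ p = 0.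
    rewrite -Z -[p in _ *+ p]card_ord -sumr_const {Z}; apply: eq_bigr => x _.
    by rewrite !mxE (const i li x0 x) (const i0 li0 x0 x).
  rewrite mulrn_eq0 -leqn0 leqNgt p_gt0 /= mulf_eq0 conjC_eq0 {Z} => Z.
  have {Z} [i1 Z] : exists i1, forall x, P i1 x = 0.
    case/orP: Z => /eqP Z; [exists i | exists i0] => x; rewrite -Z; exact: const.
  have /eqP := unit_row i1; rewrite big1 ?(eq_sym 0) ?oner_eq0 // => x _.
  by rewrite Z normr0 expr0n.
have -> : \sum_i l i = \tr A.
  rewrite {1}DA mxtrace_mulC mulmxA PP mul1mx mxtrace_diag.
  by apply: eq_bigr.
rewrite /mxtrace (eq_bigr (fun=> c%:R)) ?sumr_const ?card_ord ?mulr_natl // => x _.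
rewrite mxE -(row_sum x) natr_sum; apply: eq_bigr => y _.
by rewrite !mxE -natrM mulnb andbb.
Qed.

End Gram.

(** * The two chains of a biregular graph *)

Lemma sum_nat_pred1 (T : finType) (A : comNzRingType) (x : T) (F : T -> A) :
  \sum_y (x == y)%:R * F y = F x.
Proof.
rewrite (bigD1 x) //= eqxx mul1r big1 ?addr0 // => y yx.
by rewrite eq_sym (negPf yx) mul0r.
Qed.

Lemma sum_parts (T : finType) (A : zmodType) (X : {set T}) (F : T -> A) :
  \sum_(i < #|X|) F (enum_val i) + \sum_(i < #|~: X|) F (enum_val i) = \sum_v F v.
Proof.
rewrite -!big_enum_val /= [RHS](bigID (mem X)) /=; congr (_ + _).
by apply: eq_bigl => v; rewrite inE.
Qed.

Section Biregular.

Variables (V : finType) (e : rel V) (X : {set V}) (c d : nat).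
Hypothesis e_sym : symmetric e.
Hypothesis e_cut : forall u v, e u v -> (u \in X) != (v \in X).
Hypothesis degX : forall v, v \in X -> deg e v = c.
Hypothesis degY : forall v, v \notin X -> deg e v = d.

Local Notation N := #|Defs.arc e|.
Local Notation p := #|X|.
Local Notation q := #|~: X|.
Local Notation tl i := (val (enum_val (i : 'I_N))).1.
Local Notation hd i := (val (enum_val (i : 'I_N))).2.

Let xv (i : 'I_p) : V := enum_val i.
Let yv (i : 'I_q) : V := enum_val i.

Lemma xvP i : xv i \in X. Proof. exact: enum_valP. Qed.
Lemma yvP i : yv i \notin X.
Proof. by have := enum_valP i; rewrite inE. Qed.

Definition biadj (x : 'I_p) (y : 'I_q) : bool := e (enum_val x) (enum_val y).

Lemma e_arc i : e (tl i) (hd i).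
Proof. exact: valP (enum_val i : Defs.arc e). Qed.

Lemma e_inX u v : u \in X -> e u v -> v \notin X.
Proof. by move=> uX /e_cut; rewrite uX; case: (v \in X). Qed.

Lemma e_notinX u v : u \notin X -> e u v -> v \in X.
Proof. by move=> uX /e_cut; rewrite (negPf uX); case: (v \in X). Qed.

Lemma sum_arcs (A : zmodType) (F : V -> V -> A) :
  \sum_(i < N) F (tl i) (hd i) = \sum_u \sum_(v | e u v) F u v.
Proof.
rewrite pair_big_dep /=.
rewrite (reindex (@enum_rank (Defs.arc e))) /=; last exact: onW_bij (@enum_rank_bij _).
under eq_bigr do rewrite enum_rankK.
symmetry; exact: (@big_sub _ _ _ _ [pred x : V * V | e x.1 x.2] (fun x => F x.1 x.2)).
Qed.

Lemma sum_biadjX x : (\sum_y biadj x y)%N = c.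
Proof.
rewrite -(degX _ (xvP x)) /deg -[RHS]sum1_card.
rewrite -(@big_enum_val _ _ _ _ (mem (~: X)) (fun v => nat_of_bool (e (xv x) v))).
rewrite big_mkcond [RHS]big_mkcond /=; apply: eq_bigr => v _; rewrite !inE.
case: (boolP (e _ v)) => [/(e_inX _ _ (xvP x))->//|_].
by rewrite if_same.
Qed.

Lemma sum_biadjY y : (\sum_x biadj x y)%N = d.
Proof.
rewrite -(degY _ (yvP y)) /deg -[RHS]sum1_card.
rewrite -(@big_enum_val _ _ _ _ (mem X) (fun v => nat_of_bool (e v (yv y)))).
rewrite big_mkcond [RHS]big_mkcond /=; apply: eq_bigr => v _.
rewrite !inE [e v _]e_sym.
case: (boolP (e _ v)) => [/(e_notinX _ _ (yvP y))->//|_].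
by rewrite if_same.
Qed.

Lemma card_edges : (p * c = q * d)%N.
Proof.
transitivity (\sum_x \sum_y biadj x y)%N.
  by under eq_bigr do rewrite sum_biadjX; rewrite sum_nat_const card_ord.
rewrite exchange_big /=; under eq_bigr do rewrite sum_biadjY.
by rewrite sum_nat_const card_ord.
Qed.

Lemma card_arcs : N = (p * c + q * d)%N.
Proof.
(* [sum_arcs] needs values in an additive group, so the count is done in [int]. *)
apply/eqP; rewrite -(eqr_nat int); apply/eqP.
have := sum_arcs int (fun _ _ => 1); rewrite sumr_const card_ord => ->.
rewrite -(sum_parts _ _ X) natrD; congr (_ + _).
  rewrite (eq_bigr (fun=> c%:R)) ?sumr_const ?card_ord ?natrM ?mulr_natl // => x _.
  by rewrite sumr_const -(degX _ (xvP x)) /deg cardsE.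
rewrite (eq_bigr (fun=> d%:R)) ?sumr_const ?card_ord ?natrM ?mulr_natl // => x _.
by rewrite sumr_const -(degY _ (yvP x)) /deg cardsE.
Qed.

Lemma biadj_conn (A : Type) (f : 'I_p -> A) : connected_graph e ->
  (forall x x' y, biadj x y -> biadj x' y -> f x = f x') ->
  forall x x', f x = f x'.
Proof.
move=> econn fP x0 x1.
(* [g] extends [f] to all vertices by a default off [X], so that it can be followed along paths. *)
pose g u := f (enum_rank_in (enum_valP x0) u).
have gx x : g (enum_val x) = f x by rewrite /g enum_valK_in.
have gP u u' w : u \in X -> u' \in X -> e u w -> e u' w -> g u = g u'.
  move=> uX u'X euw eu'w.
  have wY : w \in ~: X by rewrite inE (e_inX _ _ uX euw).
  apply: (fP _ _ (enum_rank_in wY w)).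
    by rewrite /biadj !enum_rankK_in.
  by rewrite /biadj !enum_rankK_in.
(* The invariant along a path: a vertex of [X] has the value at [x0], and a vertex off [X] has only
   neighbours with that value. *)
pose Q u := if u \in X then g u = g (xv x0)
            else forall w, e u w -> g w = g (xv x0).
have Qstep u w : e u w -> Q u -> Q w.
  rewrite /Q; case: ifPn => uX euw.
    rewrite (negPf (e_inX _ _ uX euw)) => gu w' eww'.
    rewrite -gu; apply: (gP _ _ w) => //; last by rewrite e_sym.
    exact: e_notinX (e_inX _ _ uX euw) eww'.
  by rewrite (e_notinX _ _ uX euw); apply.
have : Q (xv x1).
  have /connectP[s ps ->] := econn (xv x0) (xv x1).
  have : Q (xv x0) by rewrite /Q xvP.
  elim: s (xv x0) ps => //= u s IH w /andP[ewu pu] Qw.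
  by apply: IH => //; apply: Qstep Qw.
by rewrite /Q xvP !gx.
Qed.

(** * Factoring the chains through the vertices *)

(** With [tails], this factors a step of the walk as arc to head vertex to outgoing arc. Sylvester's
    identity then exchanges the factors and leaves a matrix indexed by vertices, those of [X] first.
    The weight is the transition probability at the head. *)
Definition heads (w : V -> algC) : 'M[algC]_(N, p + q) :=
  row_mx (\matrix_(i, x) ((hd i == enum_val x)%:R * w (hd i)))
         (\matrix_(i, y) ((hd i == enum_val y)%:R * w (hd i))).

Definition tails : 'M[algC]_(p + q, N) :=
  col_mx (\matrix_(x, i) (tl i == enum_val x)%:R)
         (\matrix_(y, i) (tl i == enum_val y)%:R).

Lemma heads_tails w i j : (heads w *m tails) i j = (hd i == tl j)%:R * w (hd i).
Proof.
rewrite mul_row_col !mxE.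
pose F v := (hd i == v)%:R * ((tl j == v)%:R * w (hd i)).
transitivity (\sum_v F v).
  rewrite -(sum_parts _ _ X); congr (_ + _);
  by apply: eq_bigr => x _; rewrite !mxE /F; ring.
by rewrite sum_nat_pred1 eq_sym.
Qed.

Local Notation B := (\matrix_(x < p, y < q) (biadj x y)%:R : 'M[algC]_(p, q)).

Lemma sum_tail_head (w : V -> algC) u v :
  \sum_(i < N) (tl i == u)%:R * ((hd i == v)%:R * w (hd i)) = w v * (e u v)%:R.
Proof.
rewrite (sum_arcs _ (fun t h => (t == u)%:R * ((h == v)%:R * w h))).
under eq_bigr => t _ do rewrite -mulr_sumr eq_sym.
rewrite sum_nat_pred1 big_mkcond.
rewrite -[RHS](sum_nat_pred1 _ _ v (fun h => w h * (e u h)%:R)).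
apply: eq_bigr => h _; rewrite [v == h]eq_sym.
by case: (e u h); rewrite ?mulr1 ?mulr0.
Qed.

Lemma sum_tail_tail u v :
  \sum_(i < N) (tl i == u)%:R * (tl i == v)%:R = ((u == v)%:R * (deg e u)%:R) :> algC.
Proof.
rewrite (sum_arcs _ (fun t h => (t == u)%:R * (t == v)%:R)).
rewrite -[RHS](sum_nat_pred1 _ _ u (fun t => (t == v)%:R * (deg e t)%:R)).
apply: eq_bigr => t _.
by rewrite sumr_const -[LHS]mulr_natr /deg cardsE eq_sym mulrA.
Qed.

Section Weight.

Variables (w : V -> algC) (wX wY : algC).
Hypothesis w_X : forall v, v \in X -> w v = wX.
Hypothesis w_Y : forall v, v \notin X -> w v = wY.

(** Edges cross the bipartition, which kills the diagonal blocks. The weight sits at the head, so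
    the block from [X] to its complement carries [wY]. *)
Lemma tails_heads : tails *m heads w = block_mx 0 (wY *: B) (wX *: B^T) 0.
Proof.
rewrite mul_col_row; congr block_mx; apply/matrixP=> i j; rewrite !mxE;
  under eq_bigr do rewrite !mxE; rewrite sum_tail_head.
- case: (boolP (e _ _)) => [/(e_inX _ _ (xvP i))|_]; last by rewrite mulr0.
  by rewrite (xvP j).
- by rewrite w_Y ?yvP.
- by rewrite w_X ?xvP // e_sym.
- case: (boolP (e _ _)) => [/(e_notinX _ _ (yvP i))|_]; last by rewrite mulr0.
  by rewrite (negPf (yvP j)).
Qed.

Lemma tails_trmx : tails *m tails^T = block_mx c%:R%:M 0 0 d%:R%:M.
Proof.
rewrite tr_col_mx mul_col_row; congr block_mx; apply/matrixP=> i j; rewrite !mxE;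
  under eq_bigr do rewrite !mxE; rewrite sum_tail_tail.
- by rewrite (inj_eq enum_val_inj) degX ?xvP // mulr_natl.
- case: eqP => [E|_]; last by rewrite mul0r.
  by have := xvP i; rewrite /xv E (negPf (yvP j)).
- case: eqP => [E|_]; last by rewrite mul0r.
  by have := yvP i; rewrite /yv E (xvP j).
- by rewrite (inj_eq enum_val_inj) degY ?yvP // mulr_natl.
Qed.

Definition rev_arc (a : Defs.arc e) : Defs.arc e :=
  exist (fun x : V * V => e x.1 x.2) ((val a).2, (val a).1)
    (etrans (e_sym _ _) (valP a)).

Definition rev_idx (i : 'I_N) : 'I_N := enum_rank (rev_arc (enum_val i)).

Lemma tl_rev i : tl (rev_idx i) = hd i.
Proof. by rewrite enum_rankK. Qed.

Lemma hd_rev i : hd (rev_idx i) = tl i.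
Proof. by rewrite enum_rankK. Qed.

Lemma eq_idx (i j : 'I_N) : (i == j) = (tl i == tl j) && (hd i == hd j).
Proof. by rewrite -(inj_eq enum_val_inj) -val_eqE. Qed.

Lemma rev_idxK : involutive rev_idx.
Proof. by move=> i; apply/eqP; rewrite eq_idx tl_rev !hd_rev tl_rev !eqxx. Qed.

(** The weighted arc reversal, consisting of the moves that the non-backtracking chain forbids. Each
    arc has one end on each side, so its square is the scalar [wX * wY], which makes
    ['X + backtrack] explicitly invertible up to a scalar. *)
Definition backtrack : 'M[algC]_N := \matrix_(i, j) ((rev_idx i == j)%:R * w (hd i)).

Lemma mul_backtrack m (M : 'M[algC]_(N, m)) i j :
  (backtrack *m M) i j = w (hd i) * M (rev_idx i) j.
Proof.
rewrite mxE; under eq_bigr do rewrite mxE -mulrA; exact: sum_nat_pred1.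
Qed.

Lemma weight_ends i : w (hd i) * w (tl i) = wX * wY.
Proof.
have [tX|tY] := boolP (tl i \in X).
  by rewrite mulrC w_X // w_Y // (e_inX _ _ tX (e_arc i)).
by rewrite w_X ?w_Y // (e_notinX _ _ tY (e_arc i)).
Qed.

Lemma backtrack_sqr : backtrack *m backtrack = (wX * wY)%:M.
Proof.
apply/matrixP=> i j; rewrite mul_backtrack !mxE rev_idxK hd_rev.
by rewrite mulrCA weight_ends mulr_natl.
Qed.

Lemma backtrack_heads : backtrack *m heads w = (wX * wY) *: tails^T.
Proof.
apply/matrixP=> i j; rewrite mul_backtrack !mxE.
by case: split => k; rewrite !mxE hd_rev mulrCA weight_ends mulrC.
Qed.

(** Reversal changes the side of the tail, so conjugation by the signs [E] of the tail sides negates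
    it. With the product of the two matrices known, this determines the square of each
    determinant. *)
Lemma det_backtrack :
  \det ('X%:M + map_mx polyC backtrack) = \det ('X%:M - map_mx polyC backtrack).
Proof.
pose E : 'M[{poly algC}]_N := diag_mx (\row_i (-1) ^+ (tl i \in X)).
have EE : E *m E = 1%:M.
  rewrite mulmx_diag -diag_const_mx; congr diag_mx.
  by apply/rowP=> i; rewrite !mxE -signr_addb addbb.
have <- : E *m ('X%:M + map_mx polyC backtrack) *m E = 'X%:M - map_mx polyC backtrack.
  rewrite mulmxDr mulmxDl mul_mx_scalar -scalemxAl EE scalemx1; congr (_ + _).
  apply/matrixP=> i j; rewrite mul_mx_diag mxE mul_diag_mx !mxE.
  case: (rev_idx i =P j) => [<-|_]; last by rewrite mul0r polyC0 mulr0 mul0r oppr0.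
  rewrite tl_rev mul1r mulrAC -signr_addb.
  by move: (e_cut _ _ (e_arc i)); case: (tl i \in X) (hd i \in X) => [] [] //= _;
    rewrite expr1 mulN1r.
by rewrite !det_mulmx mulrAC -det_mulmx EE det1 mul1r.
Qed.

End Weight.

Lemma edge_chain_mx :
  trans_mx (@edge_chain V e) = heads (fun v => (deg e v)%:R^-1) *m tails.
Proof.
apply/matrixP=> i j; rewrite heads_tails mxE /edge_chain.
by case: eqP; rewrite ?mul1r ?mul0r.
Qed.

Lemma nb_chain_mx : let w v := ((deg e v)%:R - 1)^-1 in
  trans_mx (@nb_chain V e) = heads w *m tails - backtrack w.
Proof.
move=> w; apply/matrixP=> i j.
rewrite [RHS]mxE heads_tails !mxE /nb_chain /w eq_idx tl_rev hd_rev.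
rewrite [tl i == _]eq_sym.
by case: eqP; case: eqP; rewrite ?mul1r ?mul0r ?subr0 ?subrr.
Qed.

(** * Kemeny's constants in terms of the Gram spectrum *)

Variable l : 'I_p -> algC.
Hypothesis gram_det : forall f g : {poly algC},
  \det (f%:M - g *: map_mx polyC (B *m B^T)) = \prod_i (f - g * (l i)%:P).
Hypothesis c_gt1 : (1 < c)%N.
Hypothesis d_gt1 : (1 < d)%N.

(** [root_sum] is applied to both sides of the polynomial identity [fE], where each factor ['X]
    contributes 1. The powers on the left stay there instead of being divided out. *)
Lemma Kemeny_e_spectrum :
  Kemeny_e e + (p + q)%:R + p%:R =
  N%:R + q%:R + \sum_i root_sum algC ('X^2 + (- (l i / (c%:R * d%:R)))%:P).
Proof.
rewrite /Kemeny_e kemeny_root_sum edge_chain_mx.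
set w := fun v : V => (deg e v)%:R^-1; set f := char_poly _.
have w_X v : v \in X -> w v = c%:R^-1 by move=> vX; rewrite /w degX.
have w_Y v : v \notin X -> w v = d%:R^-1 by move=> vY; rewrite /w degY.
have X0 : 'X != 0 :> {poly algC} by rewrite polyX_eq0.
have fE : f * 'X ^+ (p + q) * 'X ^+ p =
    'X ^+ N * ('X ^+ q * \prod_i ('X^2 + (- (l i / (c%:R * d%:R)))%:P)).
  (* Sylvester's identity with [R = X], [R' = 1] and [y = X]. *)
  have := det_sub_mulmx _ N (p + q) 'X 'X%:M 1%:M (map_mx polyC (heads w))
    (map_mx polyC tails); rewrite mulmx1 => /(_ erefl).
  rewrite det1 mul1r -map_mxM -/(char_poly_mx _) -/(char_poly _) -/f => ->.
  rewrite mulmx1 -map_mxM (tails_heads _ _ _ w_X w_Y) map_block_mx !map_mxZ !map_mx0.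
  rewrite -mulrA; congr (_ * _).
  have -> : 'X%:M - block_mx 0 (d%:R^-1%:P *: map_mx polyC B)
       (c%:R^-1%:P *: map_mx polyC B^T) 0 =
     block_mx 'X%:M (- (d%:R^-1%:P *: map_mx polyC B))
       (- (c%:R^-1%:P *: map_mx polyC B^T)) 'X%:M.
    by rewrite scalar_mx_block opp_block_mx add_block_mx !oppr0 !addr0 !add0r.
  rewrite det_scalar_block -map_mxM gram_det mulrC; congr (_ * _).
  apply: eq_bigr => i _; rewrite -expr2 -!polyCM -polyCN; congr (_ + _%:P).
  by rewrite invfM; ring.
have R0 : 'X ^+ N * ('X ^+ q * \prod_i ('X^2 + (- (l i / (c%:R * d%:R)))%:P)) != 0.
  rewrite !mulf_neq0 ?expf_neq0 //; apply/prodf_neq0 => i _.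
  exact: quadratic_neq0.
have R1 := R0; rewrite mulf_eq0 negb_or in R1; have {R1}/andP[_ R1] := R1.
have L0 := R0; rewrite -fE in L0.
have L1 := L0; rewrite mulf_eq0 negb_or in L1; have {L1}/andP[L1 _] := L1.
have := congr1 (root_sum algC) fE.
rewrite (root_sumM _ _ _ L0) (root_sumM _ _ _ L1).
rewrite (root_sumM _ _ _ R0) (root_sumM _ _ _ R1) !root_sumX // root_sum_polyX.
rewrite root_sum_prod; last by move=> i; apply: quadratic_neq0.
by move=> ->; rewrite addrA.
Qed.

(** The Ihara-Bass analogue: [t] is the product of the two weights, [y] is the scalar [R *m R'], and
    [a] is the diagonal entry on the side of degree [d]. Everything is doubled because
    [det_backtrack] gives only the square of [\det R']. *)
Lemma Kemeny_nb_spectrum :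
  let t := ((c%:R - 1) * (d%:R - 1))^-1 : algC in
  let y := 'X^2 + (- t)%:P in
  let a := 'X^2 + (t * d%:R - t)%:P in
  2 * Kemeny_nb e + 2 * (p + q)%:R * root_sum algC y + 2 * p%:R * root_sum algC a =
  N%:R * root_sum algC y + 2 * q%:R * root_sum algC a +
  2 * \sum_i root_sum algC ('X^4 + (t * (c%:R + d%:R - 2 - l i))%:P * 'X^2 + t%:P).
Proof.
move=> t y a.
have c1 : c%:R - 1 != 0 :> algC by rewrite subr_eq0 -[1]/(1%:R) eqr_nat gtn_eqF.
have d1 : d%:R - 1 != 0 :> algC by rewrite subr_eq0 -[1]/(1%:R) eqr_nat gtn_eqF.
rewrite /Kemeny_nb kemeny_root_sum nb_chain_mx.
set w := fun v : V => ((deg e v)%:R - 1)^-1; set f := char_poly _; set K := backtrack w.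
have w_X v : v \in X -> w v = (c%:R - 1)^-1 by move=> vX; rewrite /w degX.
have w_Y v : v \notin X -> w v = (d%:R - 1)^-1 by move=> vY; rewrite /w degY.
have tE : t = (c%:R - 1)^-1 * (d%:R - 1)^-1 by rewrite /t invfM.
pose H := map_mx polyC (heads w); pose S := map_mx polyC tails.
pose R := 'X%:M + map_mx polyC K; pose R' := 'X%:M - map_mx polyC K.
pose Q := \prod_i ('X^4 + (t * (c%:R + d%:R - 2 - l i))%:P * 'X^2 + t%:P).
have RR' : R *m R' = y%:M.
  rewrite /R /R' mulmxBr !mulmxDl !mul_scalar_mx !mul_mx_scalar -map_mxM.
  rewrite (backtrack_sqr _ _ _ w_X w_Y) -tE map_scalar_mx scale_scalar_mx -expr2.
  by rewrite addrKA -raddfB /= /y polyCN.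
have fE : f * (\det R' * y ^+ (p + q)) * a ^+ p = y ^+ N * (a ^+ q * Q).
  have := det_sub_mulmx _ N (p + q) y R R' H S RR'.
  have -> : R - H *m S = char_poly_mx (heads w *m tails - K).
    by rewrite /char_poly_mx map_mxB map_mxM opprB addrA.
  rewrite -/(char_poly _) -/f => ->; rewrite -mulrA; congr (_ * _).
  (* By [backtrack_heads], the reversal part of [R'] turns into [t] times [tails *m tails^T]. This
     puts the degrees, times [t], on the diagonal. *)
  have -> : y%:M - S *m R' *m H =
     block_mx ('X^2 + (t * c%:R - t)%:P)%:M (- (('X * (d%:R - 1)^-1%:P) *: map_mx polyC B))
       (- (('X * (c%:R - 1)^-1%:P) *: map_mx polyC B^T)) a%:M.
    rewrite /R' mulmxBr mulmxBl mul_mx_scalar -scalemxAl -!mulmxA -!map_mxM.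
    rewrite (backtrack_heads _ _ _ w_X w_Y) -tE -scalemxAr tails_trmx.
    rewrite (tails_heads _ _ _ w_X w_Y).
    rewrite map_mxZ !map_block_mx !map_mxZ !map_scalar_mx !map_mx0.
    rewrite !scale_block_mx !scaler0 !scalerA scalar_mx_block opprB addrA.
    rewrite !opp_block_mx !add_block_mx !oppr0 !addr0 !add0r.
    rewrite !scale_scalar_mx -!raddfD /=.
    by congr (block_mx _%:M _ _ _%:M); rewrite /y /a; ring.
  rewrite det_scalar_block -map_mxM gram_det mulrC; congr (_ * _).
  apply: eq_bigr => i _; rewrite /a.
  (* The product of the constant terms of the two diagonal blocks collapses because
     [t * (c - 1) * (d - 1) = 1]. *)
  have tt : (t * c%:R - t) * (t * d%:R - t) = t by rewrite /t; field; rewrite c1 d1.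
  rewrite -[X in _ = _ + X%:P]tt.
  have -> : 'X * (d%:R - 1)^-1%:P * ('X * (c%:R - 1)^-1%:P) = 'X^2 * t%:P :> {poly algC}.
    by rewrite tE polyCM; ring.
  by ring.
have y0 : y != 0 by apply: quadratic_neq0.
have a0 : a != 0 by apply: quadratic_neq0.
have R0 : y ^+ N * (a ^+ q * Q) != 0.
  rewrite !mulf_neq0 ?expf_neq0 //; apply/prodf_neq0 => i _.
  exact: quartic_neq0.
have R1 := R0; rewrite mulf_eq0 negb_or in R1; have {R1}/andP[_ R1] := R1.
have L0 := R0; rewrite -fE in L0.
have L1 := L0; rewrite mulf_eq0 negb_or in L1; have {L1}/andP[L1 _] := L1.
have L2 := L1; rewrite mulf_eq0 negb_or in L2; have {L2}/andP[_ L2] := L2.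
have := congr1 (root_sum algC) fE.
rewrite (root_sumM _ _ _ L0) (root_sumM _ _ _ L1) (root_sumM _ _ _ L2).
rewrite (root_sumM _ _ _ R0) (root_sumM _ _ _ R1) !root_sumX //.
rewrite root_sum_prod; last by move=> i; apply: quartic_neq0.
(* [\det R] and [\det R'] are equal and their product is [y ^+ N]. *)
have R'2 : 2 * root_sum algC (\det R') = N%:R * root_sum algC y.
  have detRR : \det R' * \det R' = y ^+ N.
    rewrite -det_scalar -RR' det_mulmx; congr (_ * _).
    exact/esym/det_backtrack.
  have := congr1 (root_sum algC) detRR; rewrite root_sumM ?detRR ?expf_neq0 //.
  by rewrite root_sumX // mulr_natl mulr2n mulr_natl.
move=> fS; transitivity (2 * (root_sum algC f + (root_sum algC (\det R') +
  root_sum algC y *+ (p + q)) + root_sum algC a *+ p) - 2 * root_sum algC (\det R')).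
  by ring.
by rewrite fS R'2; ring.
Qed.

End Biregular.

(** * The remaining inequality between the degrees and the part size *)

(** The witness [k] is the difference of the two sides minus one. Below it is a polynomial with
    nonnegative coefficients, so that only a ring identity remains. *)
Lemma ltn_of_addl (m n k : nat) : n = (m + k.+1)%N -> (m < n)%N.
Proof. lia. Qed.

(** The cases [d >= 4], [d = 3] and [d = 2] are treated separately. Shifting each variable by its
    lower bound in the case makes all coefficients of the difference nonnegative. *)
Lemma size_inequality (c d p T : nat) : (2 <= d <= c)%N -> (d <= p)%N ->
  (T + c + d = c * d)%N -> (c, d) != (2%N, 2%N) ->
  ~~ [&& p == 2, d == 2 & (c <= 5)]%N -> ~~ [&& p == 3, d == 3 & c == 3]%N ->
  (p * d.-1 * (p * T + c) < (c + d) * p.-1 ^ 2 * T)%N.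
Proof.
move=> /andP[d2 dc] dp TE; rewrite xpair_eqE => c22 H1 H2.
have [d4|d4] := leqP 4 d.
  have [j dE] : exists j, d = (4 + j)%N by exists (d - 4)%N; lia.
  have [k cE] : exists k, c = (4 + j + k)%N by exists (c - d)%N; lia.
  have [r pE] : exists r, p = (4 + j + r)%N by exists (p - d)%N; lia.
  have TE' : T = (8 + 6 * j + j * j + 3 * k + j * k)%N by subst; lia.
  rewrite TE' {TE TE' H1 H2 d2 dc dp d4 c22} pE cE dE.
  apply: (ltn_of_addl _ _ (
    143 + 180 * r + 40 * r * r + 132 * k + 117 * k * r + 23 * k * r * r +
    27 * k * k + 18 * k * k * r + 3 * k * k * r * r + 312 * j + 249 * j *
    r + 38 * j * r * r + 197 * j * k + 117 * j * k * r + 14 * j * k * r *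
    r + 27 * j * k * k + 12 * j * k * k * r + j * k * k * r * r + 241
    * j * j + 123 * j * j * r + 11 * j * j * r * r + 105 * j * j * k + 38
    * j * j * k * r + 2 * j * j * k * r * r + 9 * j * j * k * k + 2 * j *
    j * k * k * r + 87 * j * j * j + 26 * j * j * j * r + j * j * j *
    r * r + 24 * j * j * j * k + 4 * j * j * j * k * r + j * j * j * k
    * k + 15 * j * j * j * j + 2 * j * j * j * j * r + 2 * j * j * j * j *
    k + j * j * j * j * j)%N).
  by rewrite /=; ring.
have [d3|d3] := eqVneq d 3.
  have [c4|c4] := leqP 4 c.
    have [k cE] : exists k, c = (4 + k)%N by exists (c - 4)%N; lia.
    have [r pE] : exists r, p = (3 + r)%N by exists (p - 3)%N; lia.
    have TE' : T = (5 + 2 * k)%N by subst; lia.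
    rewrite TE' {TE TE' H1 H2 d2 dc dp d4 c22 c4} pE cE d3.
    apply: (ltn_of_addl _ _ (
    25 + 72 * r + 25 * r * r + 34 * k + 50 * k * r + 15 * k * r * r + 8 *
    k * k + 8 * k * k * r + 2 * k * k * r * r)%N).
    by rewrite /=; ring.
  (* Here [c = d = 3], and [H2] excludes [p = 3]. *)
  have [r pE] : exists r, p = (4 + r)%N by exists (p - 4)%N; lia.
  have cE : c = 3 by lia.
  have TE' : T = 3 by subst; lia.
  rewrite TE' {TE TE' H1 H2 d2 dc dp d4 c22 c4} pE cE d3.
  apply: (ltn_of_addl _ _ (
    41 + 54 * r + 12 * r * r)%N).
  by rewrite /=; ring.
have {}d2 : d = 2 by lia.
have [p3|p3] := leqP 3 p.
  have [k cE] : exists k, c = (3 + k)%N by exists (c - 3)%N; lia.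
  have [r pE] : exists r, p = (3 + r)%N by exists (p - 3)%N; lia.
  have TE' : T = (1 + k)%N by subst; lia.
  rewrite TE' {TE TE' H1 H2 dc dp d3 d4 c22 p3} pE cE d2.
  apply: (ltn_of_addl _ _ (
    1 + 11 * r + 4 * r * r + 12 * k + 17 * k * r + 5 * k * r * r + 4 * k *
    k + 4 * k * k * r + k * k * r * r)%N).
  by rewrite /=; ring.
have p2 : p = 2 by lia.
(* With [p = d = 2], [H1] forces [c >= 6]. *)
have [k cE] : exists k, c = (6 + k)%N by exists (c - 6)%N; lia.
have TE' : T = (4 + k)%N by subst; lia.
rewrite TE' {TE TE' H1 H2 dc dp d3 d4 c22 p3} p2 cE d2.
apply: (ltn_of_addl _ _ (
    3 + 6 * k + k * k)%N).
by rewrite /=; ring.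
Qed.

(** * The gap in terms of the spectrum *)

Section Gap.

Variable C : numClosedFieldType.

(* Cauchy-Schwarz in tangent-line form: [1 / u >= 2 t - t^2 u]. *)
Lemma sum_inv_ge (I : finType) (P : pred I) (u : I -> C) (n s : C) :
  (forall i, P i -> 0 < u i) -> \sum_(i | P i) 1 = n -> \sum_(i | P i) u i = s ->
  0 < s -> n ^+ 2 / s <= \sum_(i | P i) (u i)^-1.
Proof.
move=> u_gt0 nE sE s_gt0; have s0 : s != 0 by rewrite gt_eqF.
(* The tangent is taken at the mean of the [u i], whose inverse is [n / s]. *)
have -> : n ^+ 2 / s = \sum_(i | P i) (2 * (n / s) * 1 - (n / s) ^+ 2 * u i).
  by rewrite sumrB -!mulr_sumr nE sE; field.
(* The order on [C] is partial: a square is nonnegative only once its base is known to be real. *)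
have sR : s \is Num.real by rewrite gtr0_real.
have nR : n \is Num.real.
  by rewrite -nE; apply: rpred_sum => i _; exact: real1.
apply: ler_sum => i Pi; have ui := u_gt0 i Pi; have ui0 : u i != 0 by rewrite gt_eqF.
rewrite -subr_ge0 mulr1.
have -> : (u i)^-1 - (2 * (n / s) - (n / s) ^+ 2 * u i) = (1 - n / s * u i) ^+ 2 / u i.
  by field; rewrite s0 ui0.
rewrite divr_ge0 ?(ltW ui) // real_exprn_even_ge0 //.
by rewrite !(rpredB, rpredM, rpredV) ?real1 // gtr0_real.
Qed.

(* [p] vertices of degree [c], [q] of degree [d], and [S] is the sum of
   [1 / (1 - s)] over the non-principal eigenvalues [s] of the two-step walk. *)
Lemma kemeny_gap (Ke Knb S p q c d : C) (N := p * c + q * d)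
    (t := ((c - 1) * (d - 1))^-1) (y := 2 / (1 - t)) (a := 2 / (1 + (t * d - t))) :
  p * c = q * d -> c != 0 -> d != 0 -> c - 1 != 0 -> d - 1 != 0 -> c * d - c - d != 0 ->
  Ke + (p + q) + p = N + q + (2^-1 + 2 * S) ->
  2 * Knb + 2 * (p + q) * y + 2 * p * a =
  N * y + 2 * q * a + 2 * ((2^-1 + 2 / (1 - t)) +
    (2 * (p - 1) + 2 * ((c * d - c - d) / (c * d)) * S)) ->
  Ke - Knb = 2 * (S * (c + d) / (c * d) - p / c - (c * d - c - d)^-1).
Proof.
rewrite {}/N => pq c0 d0 c1 d1 T0 KeE KnbE.
have two : 2 != 0 :> C by rewrite pnatr_eq0.
have qE : q = p * c / d by rewrite pq mulfK.
have yE : y = 2 * ((c - 1) * (d - 1)) / (c * d - c - d).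
  have tE : 1 - t = (c * d - c - d) * t by rewrite /t; field; rewrite c1 d1.
  by rewrite /y tE invfM /t invrK; ring.
have aE : a = 2 * (c - 1) / c.
  have tE : 1 + (t * d - t) = c / (c - 1) by rewrite /t; field; rewrite c1 d1.
  by rewrite /a tE invf_div mulrA.
apply: (mulfI two).
have -> : 2 * (Ke - Knb) = 2 * (Ke + (p + q) + p) - (2 * Knb + 2 * (p + q) * y + 2 * p * a)
   - 2 * (p + q) - 2 * p + 2 * (p + q) * y + 2 * p * a by ring.
rewrite KeE KnbE -/y yE aE qE.
by field; rewrite c0 d0 T0.
Qed.

(** The index [i0] is split off: its quadratic and its quartic vanish at 1 and give the constants in
    [kemeny_gap]. The other factors are regular at 1. *)
Lemma kemeny_gap_spectrum (n : nat) (l : 'I_n -> C) (i0 : 'I_n) (Ke Knb N q c d : C)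
    (t := ((c - 1) * (d - 1))^-1) (y := 'X^2 + (- t)%:P)
    (a := 'X^2 + (t * d - t)%:P) :
  n%:R * c = q * d -> N = n%:R * c + q * d ->
  c != 0 -> d != 0 -> c - 1 != 0 -> d - 1 != 0 -> c * d - c - d != 0 ->
  l i0 = c * d -> (forall i, i != i0 -> l i != c * d) ->
  Ke + (n%:R + q) + n%:R =
    N + q + \sum_i root_sum C ('X^2 + (- (l i / (c * d)))%:P) ->
  2 * Knb + 2 * (n%:R + q) * root_sum C y + 2 * n%:R * root_sum C a =
    N * root_sum C y + 2 * q * root_sum C a +
    2 * \sum_i root_sum C ('X^4 + (t * (c + d - 2 - l i))%:P * 'X^2 + t%:P) ->
  Ke - Knb = 2 * ((\sum_(i | i != i0) (1 - l i / (c * d))^-1) * (c + d) / (c * d)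
                  - n%:R / c - (c * d - c - d)^-1).
Proof.
move=> nq NE c0 d0 c1 d1 T0 li0 l_neq KeE KnbE.
have cd0 : c * d != 0 by rewrite mulf_neq0.
have t0 : t != 0 by rewrite invr_neq0 ?mulf_neq0.
have tE : 1 - t = (c * d - c - d) * t by rewrite /t; field; rewrite c1 d1.
have t1 : 1 - t != 0 by rewrite tE mulf_neq0.
have u0 i : i != i0 -> 1 - l i / (c * d) != 0.
  move=> /l_neq li; apply: contra li; rewrite subr_eq0 eq_sym => /eqP E.
  by rewrite -[l i](divfK cd0) E mul1r.
have aE : 1 + (t * d - t) = c / (c - 1) by rewrite /t; field; rewrite c1 d1.
have ya : root_sum C y = 2 / (1 - t) by rewrite root_sum_quadratic.
have aa : root_sum C a = 2 / (1 + (t * d - t)).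
  by rewrite root_sum_quadratic // aE mulf_neq0 ?invr_eq0.
apply: (@kemeny_gap Ke Knb _ n%:R q c d) => //.
  rewrite KeE NE (bigD1 i0) //= li0 divff // root_sum_X2sub1 mulr_sumr.
  congr (_ + (_ + _)); apply: eq_bigr => i /u0 ui.
  by rewrite root_sum_quadratic.
rewrite -/t -ya -aa KnbE -NE (bigD1 i0) //= root_sum_quartic1 //; last first.
  by rewrite li0 -[LHS]subr0 -(subrr t) /t; field; rewrite c1 d1.
congr (_ + 2 * (_ + _)); first by rewrite ya.
have -> : 2 * (n%:R - 1) = \sum_(i < n | i != i0) 2 :> C.
  rewrite (_ : n%:R = \sum_(i < n) 1); last by rewrite sumr_const card_ord.
  by rewrite (bigD1 i0) //= [1 + _]addrC addrK mulr_sumr mulr1.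
rewrite mulr_sumr -big_split /=; apply: eq_bigr => i ii0.
have kE : 1 + t * (c + d - 2 - l i) + t = t * (c * d) * (1 - l i / (c * d)).
  by rewrite /t; field; rewrite c0 d0 c1 d1.
rewrite root_sum_quartic; last by rewrite kE !mulf_neq0 // u0.
(* The numerator is twice the denominator plus [2 * (1 - t)]. Each quartic thus contributes 2 plus a
   multiple of [(1 - l i / (c * d))^-1], the multiple being the same for every [i]. *)
have -> : 4 + 2 * (t * (c + d - 2 - l i)) =
    2 * (t * (c * d) * (1 - l i / (c * d))) + 2 * ((c * d - c - d) * t).
  by rewrite -kE -tE; ring.
rewrite kE; move: (1 - l i / (c * d)) (u0 i ii0) => u nu.
by field; rewrite c0 d0 nu t0.
Qed.

End Gap.

(** * Complete bipartite graphs and the final comparison *)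

Lemma complete_bipartite_iso (V : finType) (e : rel V) (X : {set V}) (m n : nat) :
  (forall u v, e u v = ((u \in X) != (v \in X))) -> #|X| = m -> #|~: X| = n ->
  graph_iso e (Kbip m n).
Proof.
move=> eE <- <-.
pose h (z : 'I_#|X| + 'I_#|~: X|) : V :=
  match z with inl i => enum_val i | inr j => enum_val j end.
have hX z : (h z \in X) = is_inl z.
  case: z => [i|j] /=; first by rewrite (enum_valP i).
  by apply/negbTE; have := enum_valP j; rewrite inE.
have h_inj : injective h.
  move=> z z' E; have := hX z; rewrite E hX.
  by case: z z' E => [i|j] [i'|j'] //= /enum_val_inj ->.
have [|g hK gK] := inj_card_bij h_inj.
  by rewrite card_sum !card_ord cardsC.
exists g; split; first by exists h.
by move=> u v; rewrite /Kbip -!hX !gK eE.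
Qed.

(** The neighbours of a vertex off [X] lie in [X], so [d <= #|X|], and equality forces the graph to
    be [Kbip d c]. The exceptions of [size_inequality] are thereby exactly the excluded graphs. *)
Lemma Kemeny_lt_of_le (V : finType) (e : rel V) (X : {set V}) (c d : nat) :
  symmetric e -> (forall u v, e u v -> (u \in X) != (v \in X)) ->
  (forall v, v \in X -> deg e v = c) -> (forall v, v \notin X -> deg e v = d) ->
  (0 < #|V|)%N -> connected_graph e -> (2 <= d <= c)%N -> (c, d) != (2%N, 2%N) ->
  ~ graph_iso e (Kbip 2 3) -> ~ graph_iso e (Kbip 2 4) ->
  ~ graph_iso e (Kbip 2 5) -> ~ graph_iso e (Kbip 3 3) ->
  Kemeny_nb e < Kemeny_e e.
Proof.
move=> e_sym e_cut degX degY V0 conn cd cd22 K23 K24 K25 K33.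
have /andP[d2 dc] := cd; have c2 := leq_trans d2 dc.
have c_gt0 := ltnW c2; have d_gt0 := ltnW d2.
have c1_gt0 : (0 < c.-1)%N by rewrite -ltnS prednK.
have d1_gt0 : (0 < d.-1)%N by rewrite -ltnS prednK.
have nbrY y : y \notin X -> [set w | e y w] \subset X.
  by move=> yX; apply/subsetP=> w; rewrite inE; apply: (e_notinX _ _ _ e_cut).
have [y0 y0X] : exists y, y \notin X.
  case/card_gt0P: V0 => v _; have [vX|] := boolP (v \in X); last by exists v.
  have : (0 < deg e v)%N by rewrite degX.
  case/card_gt0P => w; rewrite inE => evw; exists w.
  exact: (e_inX _ _ _ e_cut _ _ vX evw).
have dp : (d <= #|X|)%N by rewrite -(degY _ y0X); apply: subset_leq_card (nbrY _ y0X).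
have edges := card_edges _ _ _ _ _ e_sym e_cut degX degY.
have iso : #|X| = d -> graph_iso e (Kbip d c).
  move=> Xd; apply: (complete_bipartite_iso _ _ X) => //; last first.
    by apply/eqP; rewrite -(eqn_pmul2r d_gt0) -edges Xd mulnC.
  have YX u v : u \notin X -> v \in X -> e u v.
    move=> uX vX; have /eqP NE : [set w | e u w] == X.
      by rewrite eqEcard nbrY //= Xd -(degY _ uX).
    by rewrite -NE inE in vX.
  move=> u v; apply/idP/idP => [|]; first exact: e_cut.
  have [uX|uX] := boolP (u \in X); have [vX|vX] := boolP (v \in X) => // _.
    by rewrite e_sym YX.
  exact: YX.
(* The truncated subtraction is exact, since [c, d >= 2] gives [c + d <= c * d]; [T] is positive
   because [(2, 2)] is excluded. *)
pose T := (c * d - c - d)%N.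
have TE : (T + c + d = c * d)%N by rewrite /T; nia.
have T_gt0 : (0 < T)%N.
  by move: cd22; rewrite xpair_eqE /T; nia.
have ineq : (#|X| * d.-1 * (#|X| * T + c) < (c + d) * #|X|.-1 ^ 2 * T)%N.
  apply: size_inequality => //.
    apply/negP => /and3P[/eqP p2 /eqP d2' c5]; rewrite {}p2 {}d2' in iso cd cd22.
    have := iso erefl.
    by case: c cd cd22 c5 {degX c2 c_gt0 c1_gt0 dc edges iso TE T_gt0 T} =>
      [|[|[|[|[|[|]]]]]].
  apply/negP => /and3P[/eqP p3 /eqP d3 /eqP c3]; rewrite p3 d3 c3 in iso.
  exact: K33 (iso erefl).
have p_gt0 : (0 < #|X|)%N by apply: leq_trans dp; apply: ltnW.
have [l [i0 [gram_det li0 l_lt l_sum]]] := gram_spectrum algC _ _ _ _ (biadj V e X)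
  (sum_biadjX _ _ _ _ e_cut degX) (sum_biadjY _ _ _ _ e_sym e_cut degY)
  d_gt0 p_gt0 (fun v => biadj_conn _ _ _ e_sym e_cut _ v conn).
have KeE := Kemeny_e_spectrum _ _ _ _ _ e_sym e_cut degX degY _ gram_det.
have /= KnbE := Kemeny_nb_spectrum _ _ _ _ _ e_sym e_cut degX degY _ gram_det c2 d2.
have arcs := card_arcs _ _ _ _ _ degX degY.
have natr_neq0 n : (0 < n)%N -> n%:R != 0 :> algC by rewrite pnatr_eq0 lt0n.
have predE n : (0 < n)%N -> n%:R - 1 = n.-1%:R :> algC.
  by case: n => // n _; rewrite -addn1 natrD addrK addn1.
have TC : T%:R = c%:R * d%:R - c%:R - d%:R :> algC.
  by rewrite -natrM -TE !natrD; ring.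
set p := #|X| in edges arcs dp ineq p_gt0 l i0 gram_det li0 l_lt l_sum KeE KnbE *.
have c0 : c%:R != 0 :> algC by apply: natr_neq0.
have d0 : d%:R != 0 :> algC by apply: natr_neq0.
have T0 : T%:R != 0 :> algC by apply: natr_neq0.
have p0 : p%:R != 0 :> algC by apply: natr_neq0.
have c1 : c%:R - 1 != 0 :> algC by rewrite predE ?natr_neq0.
have d1 : d%:R - 1 != 0 :> algC by rewrite predE ?natr_neq0.
have cd_gt0 : 0 < c%:R * d%:R :> algC by rewrite -natrM ltr0n muln_gt0 c_gt0.
have l_neq i : i != i0 -> l i != c%:R * d%:R by move=> /l_lt; rewrite lt_neqAle => /andP[].
rewrite natrD in KeE KnbE.
have edgesC : p%:R * c%:R = #|~: X|%:R * d%:R :> algC by rewrite -!natrM edges.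
have arcsC : #|Defs.arc e|%:R = p%:R * c%:R + #|~: X|%:R * d%:R :> algC.
  by rewrite -!natrM -natrD arcs.
rewrite -subr_gt0 (kemeny_gap_spectrum _ _ _ _ _ _ _ _ _ _ edgesC arcsC c0 d0 c1 d1
  _ li0 l_neq KeE KnbE) -TC //.
pose u i := 1 - l i / (c%:R * d%:R).
have u_gt0 i : i != i0 -> 0 < u i.
  by move=> /l_lt li; rewrite subr_gt0 ltr_pdivrMr // mul1r.
have card_p : \sum_(i < p | i != i0) 1 = p%:R - 1 :> algC.
  have -> : p%:R = \sum_(i < p) 1 :> algC by rewrite sumr_const card_ord.
  by rewrite [in RHS](bigD1 i0) //= [1 + _]addrC addrK.
(* The trace [p * c], less the principal eigenvalue [c * d], fixes this sum. *)
have u_sum : \sum_(i | i != i0) u i = p%:R * (d%:R - 1) / d%:R.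
  rewrite sumrB card_p -mulr_suml.
  have -> : \sum_(i | i != i0) l i = p%:R * c%:R - c%:R * d%:R.
    by rewrite -l_sum -li0 [in RHS](bigD1 i0) //= [l i0 + _]addrC addrK.
  by field; rewrite c0 d0.
have s_gt0 : 0 < p%:R * (d%:R - 1) / d%:R :> algC.
  by rewrite predE // divr_gt0 ?mulr_gt0 ?ltr0n.
have S_ge := sum_inv_ge _ _ _ u _ _ u_gt0 card_p u_sum s_gt0.
have k_gt0 : 0 < (c%:R + d%:R) / (c%:R * d%:R) :> algC.
  by rewrite divr_gt0 // -natrD ltr0n addn_gt0 c_gt0.
rewrite pmulr_rgt0 ?ltr0n // -mulrA.
have := ler_wpM2r (ltW k_gt0) S_ge; rewrite -(lerD2r (- (p%:R / c%:R) - T%:R^-1)) !addrA.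
apply: lt_le_trans.
(* Over a common denominator, the numerator is the difference of the two sides of [ineq]. *)
have -> : (p%:R - 1) ^+ 2 / (p%:R * (d%:R - 1) / d%:R) * ((c%:R + d%:R) / (c%:R * d%:R))
    - p%:R / c%:R - T%:R^-1 =
  ((c%:R + d%:R) * (p%:R - 1) ^+ 2 * T%:R - p%:R * (d%:R - 1) * (p%:R * T%:R + c%:R))
    / (p%:R * (d%:R - 1) * c%:R * T%:R) :> algC.
  by field; rewrite c0 d0 d1 p0 T0.
rewrite !predE //.
apply: divr_gt0; last by rewrite -!natrM ltr0n !muln_gt0 p_gt0 d1_gt0 c_gt0.
by rewrite subr_gt0 -!(natrD, natrM, natrX) ltr_nat.
Qed.

Theorem theorem4p4 (V : finType) (e : rel V) (c d : nat) :
  simple_graph e -> (0 < #|V|)%N -> connected_graph e ->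
  biregular e c d -> (2 <= c)%N -> (2 <= d)%N -> (c, d) != (2%N, 2%N) ->
  ~ graph_iso e (Kbip 2 3) -> ~ graph_iso e (Kbip 2 4) ->
  ~ graph_iso e (Kbip 2 5) -> ~ graph_iso e (Kbip 3 3) ->
  Kemeny_nb e < Kemeny_e e.
Proof.
move=> [e_sym _] V0 conn [X [e_cut degX degY]] c2 d2 cd22 K23 K24 K25 K33.
have [dc|cd] := leqP d c.
  by apply: (Kemeny_lt_of_le _ _ X c d) => //; rewrite d2.
(* If [c < d], the two sides of the bipartition exchange roles. *)
apply: (Kemeny_lt_of_le _ _ (~: X) d c) => //.
- by move=> u v /e_cut; rewrite !inE; do 2!case: (_ \in X).
- by move=> v; rewrite inE => /degY.
- by move=> v; rewrite inE negbK => /degX.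
- by rewrite c2 ltnW.
- by move: cd22; rewrite !xpair_eqE andbC.
Qed.
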